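(* Let $\varphi\in SE$ with $\eta$-index $\rho$ and let $h:\mathbb{R}\to\mathbb{R}$. If $\mathbb{A}_{\mathrm u}$ is non-empty, then $0\in\mathbb{A}_{\mathrm u}$, and so $\mathbb{A}_{\mathrm u}$ is a subgroup of $(\mathbb{G}_+^\rho,\circ_\rho)$. In particular (taking $h=\log\varphi$), if $\eta_x^\varphi(t):=\varphi(x+t\varphi(x))/\varphi(x)\to\eta(t)$ as $x\to\infty$ locally uniformly near $t$ for some $t>0$, then this convergence is locally uniform near $t$ for all $t\ge 0$.
   Context: A function $\varphi:(0,\infty)\to(0,\infty)$ is self-equivarying, written $\varphi\in SE$, if $\varphi(x)=O(x)$ as $x\to\infty$ and there is a function $\eta=\eta^\varphi:[0,\infty)\to(0,\infty)$ such that $\varphi(x+t\varphi(x))/\varphi(x)\to\eta(t)$ as $x\to\infty$, locally uniformly in $t\in[0,\infty)$. It is known that then $\eta(t)=1+\rho t$ for some $\rho\ge 0$, called the $\eta$-index $\rho_\varphi$ of $\varphi$. Put $\rho^*:=-1/\rho$ if $\rho>0$ and $\rho^*:=-\infty$ if $\rho=0$; $\mathbb{G}_+^\rho:=(\rho^*,\infty)$, which is an abelian group under the Popa operation $s\circ_\rho t:=s+t(1+\rho s)$, with neutral element $0$ and inverse $u\mapsto -u/(1+\rho u)$. Functions $f_x$ (indexed by $x\to\infty$) converge (locally) uniformly near $t$ to the value $L\in\mathbb{R}$ if for every $\varepsilon>0$ there are $\delta>0$ and $X$ such that $|f_x(s)-L|<\varepsilon$ for all $x>X$ and all $s\in(t-\delta,t+\delta)$.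 $\mathbb{A}_{\mathrm u}$ is the set of all $t>\rho^*$ such that $s\mapsto h(x+s\varphi(x))-h(x)$ converges, as $x\to\infty$, to a finite limit uniformly near $t$ in this sense.
   Formalization: In the definition of SE, local uniformity at t=0 is required on a two-sided neighbourhood of 0 rather than only within [0,∞); with one-sided uniformity the claim fails for some discontinuous φ. *)

(* Defs.v *)
From HB Require Import structures.
From mathcomp Require Import all_boot all_order all_algebra ring lra.
From mathcomp Require Import all_classical all_reals all_analysis.
Set Implicit Arguments.
Unset Strict Implicit.
Unset Printing Implicit Defensive.
Import Order.TTheory GRing.Theory Num.Theory.
Import numFieldNormedType.Exports.
Local Open Scope classical_set_scope.
Local Open Scope ring_scope.

Definition cvg_unif_near (R : realType) (f : R -> R -> R) (t L : R) : Prop :=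
  forall eps : R, 0 < eps -> exists delta : R, 0 < delta /\
    exists X : R, forall x s : R,
      X < x -> t - delta < s < t + delta -> `|f x s - L| < eps.

Definition eta_quot (R : realType) (phi : R -> R) (x t : R) : R :=
  phi (x + t * phi x) / phi x.

(* A function (0, oo) -> (0, oo) is a total function phi that is positive on
   (0, oo). Its values on (-oo, 0] play no role: phi = O(x) makes x + s * phi x
   positive for all large x and all s bounded below by a small negative number.
   For the same reason local uniformity at t = 0 is required on a two-sided
   neighbourhood of 0, exactly as cvg_unif_near says. One-sided uniformity on
   [0, T] would allow phi to tend to 0 on the left of jumps that go off to
   infinity, and x + t * phi x would then skip large values. *)
Definition self_equivarying (R : realType) (phi eta : R -> R) : Prop :=
  [/\ forall x, 0 < x -> 0 < phi x,
      exists K : R, \forall x \near +oo%R, `|phi x| <= K * `|x|,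
      forall t, 0 <= t -> 0 < eta t &
      forall t, 0 <= t -> cvg_unif_near (eta_quot phi) t (eta t)].

Definition eta_index (R : realType) (eta : R -> R) (rho : R) : Prop :=
  0 <= rho /\ forall t, 0 <= t -> eta t = 1 + rho * t.

Definition rho_star (R : realType) (rho : R) : \bar R :=
  if 0 < rho then (- rho^-1)%:E else -oo%E.

Definition popa_set (R : realType) (rho : R) : set R :=
  [set s | (rho_star rho < s%:E)%E].

Definition popa_op (R : realType) (rho s t : R) : R := s + t * (1 + rho * s).

Definition popa_inv (R : realType) (rho u : R) : R := - u / (1 + rho * u).

Definition popa_subgroup (R : realType) (rho : R) (A : set R) : Prop :=
  [/\ A `<=` popa_set rho,
      A 0,
      forall s t, A s -> A t -> A (popa_op rho s t) &
      forall s, A s -> A (popa_inv rho s)].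

Definition A_u (R : realType) (phi : R -> R) (rho : R) (h : R -> R) : set R :=
  [set t | popa_set rho t /\
    exists L : R, cvg_unif_near (fun x s => h (x + s * phi x) - h x) t L].

Lemma popa_setE (R : realType) (rho s : R) :
  0 <= rho -> popa_set rho s <-> 0 < 1 + rho * s.
Proof.
rewrite /popa_set /rho_star /= le_eqVlt => /predU1P[<-|rho0].
  by rewrite ltxx ltNyr mul0r addr0 ltr01.
rewrite rho0 lte_fin ltrNl -[X in _ <-> is_true (0 < X)]opprK oppr_gt0.
rewrite opprD -mulrN addrC subr_lt0 mulrC -ltr_pdivlMr// div1r.
by [].
Qed.

Lemma popa_set_subgroup (R : realType) (rho : R) :
  0 <= rho -> popa_subgroup rho (popa_set rho).
Proof.
move=> rho0; split => //.
- by apply/(popa_setE _ rho0); rewrite mulr0 addr0.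
- move=> s t /(popa_setE _ rho0) ps /(popa_setE _ rho0) pt.
  apply/(popa_setE _ rho0); rewrite /popa_op.
  have -> : 1 + rho * (s + t * (1 + rho * s)) = (1 + rho * s) * (1 + rho * t).
    by ring.
  exact: mulr_gt0.
- move=> s /(popa_setE _ rho0) ps; apply/(popa_setE _ rho0); rewrite /popa_inv.
  have -> : 1 + rho * (- s / (1 + rho * s)) = (1 + rho * s)^-1.
    by field; rewrite gt_eqF.
  by rewrite invr_gt0.
Qed.

Lemma popa_opA (R : realType) (rho s t u : R) :
  popa_op rho s (popa_op rho t u) = popa_op rho (popa_op rho s t) u.
Proof. by rewrite /popa_op; ring. Qed.

Lemma popa_opC (R : realType) (rho s t : R) :
  popa_op rho s t = popa_op rho t s.
Proof. by rewrite /popa_op; ring. Qed.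

Lemma popa_op0 (R : realType) (rho s : R) : popa_op rho s 0 = s.
Proof. by rewrite /popa_op; ring. Qed.

Lemma popa_opV (R : realType) (rho s : R) :
  0 <= rho -> popa_set rho s -> popa_op rho s (popa_inv rho s) = 0.
Proof.
move=> rho0 /(popa_setE _ rho0) ps; rewrite /popa_op /popa_inv.
by field; rewrite gt_eqF.
Qed.

(* Main.v *)
Require Import Defs.
From mathcomp Require Import all_boot all_order all_algebra ring lra.
From mathcomp Require Import all_classical all_reals all_analysis.
Set Implicit Arguments.
Unset Strict Implicit.
Unset Printing Implicit Defensive.
Import Order.TTheory GRing.Theory Num.Theory.
Import numFieldNormedType.Exports.
Local Open Scope classical_set_scope.
Local Open Scope ring_scope.

(** The flow x |-> x + s * phi x composes, up to an error that vanishes at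
infinity, like the Popa group: if y = x + s * phi x, then
  x + u * phi x = y + w * phi y   with   w = (u - s) * (phi x / phi y),
and w tends to (u - s) / (1 + rho * s), because phi y / phi x tends to
1 + rho * s (lemma [rebase]).

Everything follows by choosing the intermediate point y. For
u near [popa_op rho s t], the parameter w is near t, and
  h (x + u * phi x) - h x =
    (h (y + w * phi y) - h y) + (h (x + s * phi x) - h x)
converges, so [A_u] is closed under the Popa operation ([A_u_op]). For u = 0
and y the point reached from x with a parameter near [popa_inv rho s], w is
near s and h y - h x = - (h (y + w * phi y) - h y) converges, so [A_u] is
closed under inversion ([A_u_inv]). A non-empty set closed under both contains
0.

Of s and its inverse, one is negative unless s = 0, whereas self-equivariance
controls phi (x + t * phi x) / phi x only for t >= 0. The main work is
therefore [regular_popa], the extension of this limit to the whole Popa group.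
For small t < 0, x is reached from y = x + t * phi x by a positive parameter
r * (- t) with r = phi x / phi y, so self-equivariance at y yields
r = 1 - rho * t * r + o(1), that is, r tends to 1 / (1 + rho * t)
([regular_near0]). The parameters for which the limit holds are closed under
the Popa operation ([regular_popa_op]), and finitely many short backward steps
reach every element of the group.

The second claim is one of the defining properties of self-equivariance. *)

(** * Locally uniform limits as joint limits *)

(** Limits that are uniform near t are exactly the joint limits in x -> +oo and
s -> t. Expressing them along an arbitrary filter allows the parameter to be
replaced by a quantity that depends on x and s. *)
Lemma cvg_unif_near_along (R : realType) (f : R -> R -> R) (t L : R)
    (T : Type) (F : set_system T) {FF : Filter F} (X S : T -> R) :
  cvg_unif_near f t L -> X i @[i --> F] --> +oo -> S i @[i --> F] --> t ->
  f (X i) (S i) @[i --> F] --> L.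
Proof.
move=> fL Xoo St; apply/cvgrPdist_lt => e /fL[d [d0 [A fA]]].
have /cvgryPgt/(_ A) XA := Xoo; have /cvgrPdist_lt/(_ d d0) Sd := St.
near=> i; rewrite distrC; apply: fA; first by near: i.
by rewrite -ltr_distlC; near: i.
Unshelve. all: by end_near. Qed.

Lemma cvg_unif_nearP (R : realType) (f : R -> R -> R) (t L : R) :
  f p.1 p.2 @[p --> filter_prod (pinfty_nbhs R) (nbhs t)] --> L ->
  cvg_unif_near f t L.
Proof.
move=> /cvgrPdist_lt fL e.
move=> /fL [[P Q] /= [[A [_ PA]] /nbhs_ballP[d /= d0 Qd]] PQ].
exists d; split => //; exists A => x s Ax std; rewrite distrC.
apply: (PQ (x, s)); split => /=; first exact: PA.
by apply: Qd; rewrite /ball /= ltr_distlC.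
Qed.

(** * Moving the base point along the flow *)

(** Besides the limit of the quotient, x + t * phi x must go to infinity, for
it serves as a new base point; for negative t this is not automatic. *)
Definition regular (R : realType) (phi : R -> R) (rho t : R) : Prop :=
  forall (T : Type) (F : set_system T) (FF : Filter F) (X S : T -> R),
    X i @[i --> F] --> +oo -> S i @[i --> F] --> t ->
    X i + S i * phi (X i) @[i --> F] --> +oo /\
    eta_quot phi (X i) (S i) @[i --> F] --> 1 + rho * t.

Lemma near_phi_gt0 (R : realType) (phi : R -> R)
    (T : Type) (F : set_system T) {FF : Filter F} (X : T -> R) :
  (forall x, 0 < x -> 0 < phi x) -> X i @[i --> F] --> +oo ->
  \forall i \near F, 0 < phi (X i).
Proof.
by move=> phi0 /cvgryPgt/(_ 0); apply: filterS => i; apply: phi0.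
Qed.


(** * Extending the limit of eta_quot to the Popa group *)

(** This is where phi x = O(x) is used: if phi x <= M * x and s > - 1 / (2 M),
then x + s * phi x >= x / 2. *)
Lemma small_step_pinfty (R : realType) (phi : R -> R) :
  (forall x, 0 < x -> 0 < phi x) ->
  (exists K : R, \forall x \near +oo%R, `|phi x| <= K * `|x|) ->
  exists d : R, 0 < d /\
    forall (T : Type) (F : set_system T) (FF : Filter F) (X S : T -> R),
      X i @[i --> F] --> +oo -> (\forall i \near F, - d < S i) ->
      X i + S i * phi (X i) @[i --> F] --> +oo.
Proof.
move=> phi0 [K phiK]; pose M := Num.max K 1.
have M0 : 0 < M by rewrite lt_max ltr01 orbT.
exists (2 * M)^-1; split; first by rewrite invr_gt0 mulr_gt0.
move=> T F FF X S Xoo Sd; apply/cvgryPge => A.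
have XK := Xoo _ phiK.
have /cvgryPgt/(_ 0) X0 := Xoo.
have /cvgryPge/(_ (2 * A)) XA := Xoo.
near=> i.
have x0 : 0 < X i by near: i.
have xA : 2 * A <= X i by near: i.
have xK : `|phi (X i)| <= K * `|X i| by near: i.
have sd : - (2 * M)^-1 < S i by near: i.
have p0 := phi0 _ x0.
move: xK; rewrite !gtr0_norm // => xK.
have pM : phi (X i) <= M * X i.
  by rewrite (le_trans xK)// ler_pM2r// le_max lexx.
have : - (2 * M)^-1 * phi (X i) <= S i * phi (X i).
  by rewrite ler_pM2r// ltW.
have : (2 * M)^-1 * phi (X i) <= (2 * M)^-1 * (M * X i).
  by rewrite ler_pM2l// invr_gt0 mulr_gt0.
have -> : (2 * M)^-1 * (M * X i) = X i / 2 by field; rewrite gt_eqF.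
lra.
Unshelve. all: by end_near. Qed.

(** In [regular_near0] the positive parameter - S * r leading back to the
starting point is not known to converge, only to stay bounded; this is why
uniformity on a whole segment is needed. *)
Lemma eta_quot_cvg_segment (R : realType) (phi eta : R -> R) (rho m e : R) :
  self_equivarying phi eta -> eta_index eta rho -> 0 < e ->
  \forall x \near +oo%R,
    forall s, 0 <= s <= m -> `|eta_quot phi x s - (1 + rho * s)| < e.
Proof.
move=> [_ _ _ SE] [rho0 etaE] e0.
have [/(_ (@segment_compact _ 0 m)) cover _] :=
  compact_near_coveringP `[0, m]%classic.
have H := cover _ (pinfty_nbhs R)
  (fun x s => `|eta_quot phi x s - (1 + rho * s)| < e) _.
have /H : forall s, `[0, m]%classic s ->
  \forall s' \near s & x \near +oo%R,
    `|eta_quot phi x s' - (1 + rho * s')| < e.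
  move=> s /=; rewrite in_itv /= => /andP[s0 sm].
  have c1 := cvg_unif_near_along (F := filter_prod (nbhs s) (pinfty_nbhs R))
     (SE s s0) cvg_snd cvg_fst.
  have : (eta_quot phi p.2 p.1 - (1 + rho * p.1))
    @[p --> filter_prod (nbhs s) (pinfty_nbhs R)] --> eta s - (1 + rho * s).
    apply: cvgB; first exact: c1.
    apply: cvgD; first exact: cvg_cst.
    by apply: cvgM; [exact: cvg_cst|exact: cvg_fst].
  rewrite etaE// subrr => /cvgr0_norm_lt; exact.
apply: filterS => x /= Hx s sm; apply: Hx; rewrite /= in_itv /=; exact: sm.
Qed.

(** Parameters are measured in units of phi at the base point. Moving the base
point from X to Y therefore rescales them by phi X / phi Y, which tends to
1 / (1 + rho * s). *)
Lemma rebase (R : realType) (phi : R -> R) (rho s u : R)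
    (T : Type) (F : set_system T) {FF : Filter F} (X S U : T -> R)
    (Y := fun i => X i + S i * phi (X i))
    (W := fun i => (U i - S i) * (phi (X i) / phi (Y i))) :
  0 <= rho -> (forall x, 0 < x -> 0 < phi x) ->
  popa_set rho s -> regular phi rho s ->
  X i @[i --> F] --> +oo -> S i @[i --> F] --> s -> U i @[i --> F] --> u ->
  [/\ Y i @[i --> F] --> +oo,
      W i @[i --> F] --> (u - s) / (1 + rho * s) &
      \forall i \near F, Y i + W i * phi (Y i) = X i + U i * phi (X i)].
Proof.
move=> rho0 phi0 /(popa_setE _ rho0) s0 rs Xoo Ss Uu.
have [Yoo q] := rs _ _ _ _ _ Xoo Ss.
have q0 : \forall i \near F, 0 < phi (X i + S i * phi (X i))
  by exact: near_phi_gt0.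
split => //.
- apply: cvgM; first exact: cvgB.
  rewrite (_ : (fun i => phi (X i) / phi (Y i)) =
               fun i => (eta_quot phi (X i) (S i))^-1).
    exact: cvgV (lt0r_neq0 s0) q.
  by apply/funext => i; rewrite /eta_quot invf_div.
- near=> i.
  have p0 : 0 < phi (Y i) by near: i.
  rewrite /W; transitivity (Y i + (U i - S i) * phi (X i)).
    by field; rewrite gt_eqF.
  by rewrite /Y; ring.
Unshelve. all: by end_near. Qed.

(** The quotient at [popa_op rho s t] is asymptotically the product of the
quotients at t from the new base point and at s from the old one, and
t |-> 1 + rho * t is a morphism from the Popa group to the multiplicative
group. *)
Lemma regular_popa_op (R : realType) (phi : R -> R) (rho s t : R) :
  0 <= rho -> (forall x, 0 < x -> 0 < phi x) ->
  popa_set rho s -> regular phi rho s -> regular phi rho t ->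
  regular phi rho (popa_op rho s t).
Proof.
move=> rho0 phi0 ps rs rt T F FF X U Xoo Uu.
have s0 := ps; move/(popa_setE _ rho0) in s0.
have Ss : (fun=> s) i @[i --> F] --> s by exact: cvg_cst.
have [Yoo + YWE] := rebase rho0 phi0 ps rs Xoo Ss Uu.
have -> : (popa_op rho s t - s) / (1 + rho * s) = t.
  by rewrite /popa_op; field; rewrite gt_eqF.
move=> Wt; have [YWoo YWq] := rt _ _ _ _ _ Yoo Wt.
have [_ Xq] := rs _ _ _ _ _ Xoo Ss.
have q0 : \forall i \near F, 0 < phi (X i + s * phi (X i))
  by exact: near_phi_gt0.
split; first by apply: cvg_trans YWoo; apply: near_eq_cvg.
have -> : 1 + rho * popa_op rho s t = (1 + rho * t) * (1 + rho * s).
  by rewrite /popa_op; ring.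
apply: cvg_trans (cvgM YWq Xq); apply: near_eq_cvg; near=> i.
rewrite /= /eta_quot (near YWE i)// mulrA divfK// gt_eqF//.
by near: i.
Unshelve. all: by end_near. Qed.

(** For small t < 0 the step from x to y = x + t * phi x is undone from y by a
positive parameter, which self-equivariance controls. Two-sided uniformity at 0
bounds this parameter beforehand, by keeping r = phi x / phi y below 2. The
bound rho * d < 1 places ]-d, oo[ inside the Popa group. *)
Lemma regular_near0 (R : realType) (phi eta : R -> R) (rho : R) :
  self_equivarying phi eta -> eta_index eta rho ->
  exists d : R,
    [/\ 0 < d, rho * d < 1 & forall t, - d < t -> regular phi rho t].
Proof.
move=> SEphi eta_rho.
have [phi0 phiK eta0 SE] := SEphi; have [rho0 etaE] := eta_rho.
have [d1 [d10 step]] := small_step_pinfty phi0 phiK.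
have [d2 [d20 [A close]]] := SE 0 (lexx 0) (2^-1) ltac:(lra).
(* d1 keeps x + t * phi x large, d2 gives r < 2, and (1 + rho)^-1 forces
   rho * d < 1. *)
pose d := Num.min d1 (Num.min d2 (1 + rho)^-1).
have d0 : 0 < d.
  by rewrite !lt_min d10 d20 invr_gt0 ltr_wpDr.
have dd1 : d <= d1 by rewrite !ge_min lexx.
have dd2 : d <= d2 by rewrite !ge_min lexx orbT.
have d3 : d <= (1 + rho)^-1 by rewrite !ge_min lexx !orbT.
have rd1 : rho * d < 1.
  have : d * (1 + rho) <= 1 by rewrite -ler_pdivlMr ?div1r// ltr_wpDr.
  lra.
exists d; split => // t dt T F FF X S Xoo St.
have Yoo : X i + S i * phi (X i) @[i --> F] --> +oo.
  by apply: step => //; apply: (cvgr_gt t) => //; lra.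
split => //.
have [t0|t0] := leP 0 t.
  by rewrite -etaE//; apply: cvg_unif_near_along (SE t t0) Xoo St.
pose Y i := X i + S i * phi (X i); pose r i := phi (X i) / phi (Y i).
have rt0 : 1 + rho * t != 0.
  by rewrite gt_eqF//; have := ler_wpM2l rho0 (ltW dt); lra.
have p0 : \forall i \near F, 0 < phi (X i)
  by exact: near_phi_gt0.
have q0 : \forall i \near F, 0 < phi (X i + S i * phi (X i))
  by exact: near_phi_gt0.
have XA : \forall i \near F, A < X i by move/cvgryPgt : Xoo; apply.
have Sd : \forall i \near F, - d < S i by apply: (cvgr_gt t).
have S0 : \forall i \near F, S i < 0 by apply: (cvgr_lt t).
(* This is r = 1 - rho * S * r + o(1), which is self-equivariance at Y with
   parameter - S * r: the step from Y back to X. *)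
have rS1 : r i * (1 + rho * S i) @[i --> F] --> (1 : R).
  apply/cvgrPdist_lt => e e0.
  have eY := Yoo _ (eta_quot_cvg_segment (2 * d) SEphi eta_rho e0).
  near=> i.
  have p : 0 < phi (X i) by near: i.
  have q : 0 < phi (Y i) by near: i.
  have sd : - d < S i by near: i.
  have sneg : S i < 0 by near: i.
  have r0 : 0 < r i by rewrite divr_gt0.
  have r2 : r i < 2.
    have := close (X i) (S i); rewrite etaE// mulr0 addr0 /eta_quot -/(Y i).
    have -> : phi (Y i) / phi (X i) = (r i)^-1 by rewrite invf_div.
    move=> /(_ ltac:(near: i; exact: XA) ltac:(lra)).
    rewrite ltr_distl => /andP[h1 _].
    have : (1 - 2^-1) * r i < 1 by rewrite -ltr_pdivlMr ?div1r.
    lra.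
  have : forall s, 0 <= s <= 2 * d ->
      `|eta_quot phi (Y i) s - (1 + rho * s)| < e.
    by near: i.
  move=> /(_ (- S i * r i)).
  have -> : eta_quot phi (Y i) (- S i * r i) = r i.
    rewrite /eta_quot {2}/r -mulrA divfK ?gt_eqF// /Y.
    by congr (phi _ / _); ring.
  have -> : r i - (1 + rho * (- S i * r i)) = r i * (1 + rho * S i) - 1 by ring.
  rewrite distrC; apply; apply/andP; split; first by rewrite mulr_ge0//; lra.
  nra.
have rhoS : 1 + rho * S i @[i --> F] --> 1 + rho * t.
  by apply: cvgD; [exact: cvg_cst | apply: cvgM; [exact: cvg_cst|]].
rewrite -[1 + rho * t]mulr1 -[X in _ * X]invr1.
apply: cvg_trans (cvgM rhoS (cvgV (oner_neq0 R) rS1)); apply: near_eq_cvg.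
near=> i => /=.
have p : 0 < phi (X i) by near: i.
have q : 0 < phi (Y i) by near: i.
have rs0 : 1 + rho * S i != 0.
  have sd : - d < S i by near: i.
  by rewrite gt_eqF//; have := ler_wpM2l rho0 (ltW sd); lra.
rewrite /eta_quot -/(Y i) /r.
by field; rewrite rs0 !gt_eqF.
Unshelve. all: by end_near. Qed.

(** Splitting off a backward step s = - d / 2 turns t into u with
t = [popa_op rho s u], and u >= t + (d / 2) * (1 + rho * t). As 1 + rho * t only
increases in this process, every step gains at least the fixed amount
(d / 2) * a, where a is the initial 1 + rho * t, and finitely many steps lead above - d. *)
Lemma regular_popa (R : realType) (phi eta : R -> R) (rho t : R) :
  self_equivarying phi eta -> eta_index eta rho ->
  popa_set rho t -> regular phi rho t.
Proof.
move=> SEphi eta_rho.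
have [phi0 _ _ _] := SEphi; have [rho0 _] := eta_rho.
have [d [d0 rd1 reg0]] := regular_near0 SEphi eta_rho.
move=> /(popa_setE _ rho0); set a := 1 + rho * t => a0.
pose s := - (d / 2).
have rs : 0 < 1 + rho * s <= 1.
  by rewrite /s; apply/andP; split; nra.
have [rs0 rs1] := andP rs.
have ps : popa_set rho s by apply/(popa_setE _ rho0).
suff reg n t' : a <= 1 + rho * t' -> - d < t' + n%:R * (d / 2 * a) ->
    regular phi rho t'.
  have c0 : 0 < d / 2 * a by rewrite mulr_gt0// divr_gt0.
  apply: (reg (Num.bound (`|t| / (d / 2 * a)))); first exact: lexx.
  have := archi_boundP (divr_ge0 (normr_ge0 t) (ltW c0)).
  rewrite ltr_pdivrMr// => tc; have := ler_norm (- t); rewrite normrN; lra.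
elim: n t' => [|n IH] t' at' dt'.
  by apply: reg0; rewrite mul0r addr0 in dt'.
pose u := (t' - s) / (1 + rho * s).
have -> : t' = popa_op rho s u.
  by rewrite /popa_op /u; field; rewrite gt_eqF.
apply: regular_popa_op => //; first by apply: reg0; rewrite /s; lra.
have ut : t' + d / 2 * a <= u.
  have -> : u = t' + d / 2 * (1 + rho * t') / (1 + rho * s).
    by rewrite -[d / 2]opprK -/s /u; field; rewrite gt_eqF.
  rewrite lerD2l ler_pdivlMr//.
  apply: le_trans (_ : d / 2 * a <= _); last by rewrite ler_pM2l// divr_gt0.
  by rewrite ler_piMr// mulr_ge0 ?ltW// divr_gt0.
apply: IH.
  rewrite (le_trans at')// lerD2l ler_wpM2l// (le_trans _ ut)//.
  by rewrite lerDl mulr_ge0 ?ltW// divr_gt0.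
rewrite (lt_le_trans dt')// -natr1 mulrDl mul1r.
lra.
Qed.

Lemma A_u_op (R : realType) (phi : R -> R) (rho : R) (h : R -> R) (s t : R) :
  0 <= rho -> (forall x, 0 < x -> 0 < phi x) ->
  (forall t, popa_set rho t -> regular phi rho t) ->
  A_u phi rho h s -> A_u phi rho h t -> A_u phi rho h (popa_op rho s t).
Proof.
move=> rho0 phi0 reg [ps [L hL]] [pt [M hM]].
have [_ _ popa_mul _] := popa_set_subgroup rho0.
split; first exact: popa_mul.
exists (L + M); apply: cvg_unif_nearP.
set F := filter_prod _ _.
have Xoo : p.1 @[p --> F] --> +oo by exact: cvg_fst.
have Ss : (fun=> s) p @[p --> F] --> s by exact: cvg_cst.
have Uu : p.2 @[p --> F] --> popa_op rho s t by exact: cvg_snd.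
have [Yoo + YWE] := rebase rho0 phi0 ps (reg _ ps) Xoo Ss Uu.
have -> : (popa_op rho s t - s) / (1 + rho * s) = t.
  by rewrite /popa_op; field; rewrite gt_eqF//; apply/(popa_setE _ rho0).
move=> Wt.
apply: cvg_trans (cvgD (cvg_unif_near_along hL Xoo Ss)
                       (cvg_unif_near_along hM Yoo Wt)).
apply: near_eq_cvg; near=> p => /=.
  by rewrite fctE (near YWE p)//; ring.
Unshelve. all: by end_near. Qed.

Lemma A_u_inv (R : realType) (phi : R -> R) (rho : R) (h : R -> R) (s : R) :
  0 <= rho -> (forall x, 0 < x -> 0 < phi x) ->
  (forall t, popa_set rho t -> regular phi rho t) ->
  A_u phi rho h s -> A_u phi rho h (popa_inv rho s).
Proof.
move=> rho0 phi0 reg [ps [L hL]].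
have [_ _ _ popa_V] := popa_set_subgroup rho0.
have pv := popa_V _ ps; split; first exact: pv.
have s0 : 0 < 1 + rho * s by apply/(popa_setE _ rho0).
exists (- L); apply: cvg_unif_nearP.
set F := filter_prod _ _.
have Xoo : p.1 @[p --> F] --> +oo by exact: cvg_fst.
have Ss : p.2 @[p --> F] --> popa_inv rho s by exact: cvg_snd.
have U0 : (fun=> 0 : R) p @[p --> F] --> 0 by exact: cvg_cst.
have [Yoo + YWE] := rebase rho0 phi0 pv (reg _ pv) Xoo Ss U0.
have -> : (0 - popa_inv rho s) / (1 + rho * popa_inv rho s) = s.
  rewrite /popa_inv; field; rewrite !gt_eqF//.
  by rewrite mulrN addrK.
move=> Ws.
apply: cvg_trans (cvgN (cvg_unif_near_along hL Yoo Ws)).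
apply: near_eq_cvg; near=> p => /=.
by rewrite fctE (near YWE p)// mul0r addr0 opprB.
Unshelve. all: by end_near. Qed.

Theorem theorem3 (R : realType) (phi eta : R -> R) (rho : R) (h : R -> R)
    (phi_SE : self_equivarying phi eta) (eta_rho : eta_index eta rho) :
  (A_u phi rho h !=set0 ->
     A_u phi rho h 0 /\ popa_subgroup rho (A_u phi rho h)) /\
  ((exists t : R, 0 < t /\ cvg_unif_near (eta_quot phi) t (eta t)) ->
     forall t : R, 0 <= t -> cvg_unif_near (eta_quot phi) t (eta t)).
Proof.
have [phi0 _ _ SE] := phi_SE; have [rho0 _] := eta_rho.
have reg t (pt : popa_set rho t) := regular_popa phi_SE eta_rho pt.
split=> [[u Au]|_ //].
have mul s t (As : A_u phi rho h s) (At : A_u phi rho h t) :=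
  A_u_op rho0 phi0 reg As At.
have inv s (As : A_u phi rho h s) := A_u_inv rho0 phi0 reg As.
have A0 : A_u phi rho h 0.
  by rewrite -(popa_opV rho0 (proj1 Au)); apply: mul => //; exact: inv.
by split; last split => // s [].
Qed.
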